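(* Let $A\in\mathbb{R}^{n\times n}$ be symmetric negative definite, let $C\in\mathbb{R}^{n\times s}$, and let $m\ge 1$. Let $V_{m+1}=[\mathcal{V}_1,\dots,\mathcal{V}_{m+1}]$ be an orthonormal block basis of the block Krylov subspace generated by $A$ and $C$ (as specified in the context), $V_m=[\mathcal{V}_1,\dots,\mathcal{V}_m]\in\mathbb{R}^{n\times sm}$, $C=\mathcal{V}_1\gamma$ with $\gamma\in\mathbb{R}^{s\times s}$ nonsingular, $T_m=V_m^TAV_m\in\mathbb{R}^{sm\times sm}$, and $\tau_{m+1,m}=\mathcal{V}_{m+1}^TA\mathcal{V}_m\in\mathbb{R}^{s\times s}$. Let $Y_m\in\mathbb{R}^{sm\times sm}$ be the solution of the reduced Lyapunov equation $$T_mY_m+Y_mT_m+E_1\gamma\gamma^TE_1^T=0,$$ let $X_m=V_mY_mV_m^T$, and let $R_m=AX_m+X_mA+CC^T$ be the residual matrix. Let $T_m=Q_m\Lambda_mQ_m^T$ be the eigendecomposition of $T_m$, with $Q_m$ orthogonal and $\Lambda_m=\mathrm{diag}(\lambda_1,\dots,\lambda_{sm})$. Then $$\|R_m\|_F^2=2\left(\|e_1^TS_mD_1^{-1}W_m\|_2^2+\ldots+\|e_{sm}^TS_mD_{sm}^{-1}W_m\|_2^2\right),$$ where $S_m=Q_m^TE_1\gamma\gamma^TE_1^TQ_m\in\mathbb{R}^{sm\times sm}$, $W_m=Q_m^TE_m\tau_{m+1,m}^T\in\mathbb{R}^{sm\times s}$, and $D_j=\lambda_jI_{sm}+\Lambda_m$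 for all $j=1,\dots,sm$.
   Context: The block Krylov subspaces are $\mathbf{K}_j^\square(A,C)=\mathrm{Range}\{[C,AC,\dots,A^{j-1}C]\}\subseteq\mathbb{R}^n$, $j\ge 1$. It is assumed throughout that the generated basis has full rank, i.e. $\dim \mathbf{K}_{j}^\square(A,C)=sj$ for $j=1,\dots,m+1$. The blocks $\mathcal{V}_i\in\mathbb{R}^{n\times s}$, $i=1,\dots,m+1$, are such that $V_j=[\mathcal{V}_1,\dots,\mathcal{V}_j]$ has orthonormal columns and $\mathrm{Range}(V_j)=\mathbf{K}_j^\square(A,C)$ for every $j=1,\dots,m+1$ (for example, as produced by the block Lanczos process in exact arithmetic); in particular $\mathrm{Range}(\mathcal{V}_1)=\mathrm{Range}(C)$, so $C=\mathcal{V}_1\gamma$ with $\gamma\in\mathbb{R}^{s\times s}$ nonsingular. Notation: $E_i\in\mathbb{R}^{sm\times s}$ is the $i$th block of $s$ columns of the identity matrix $I_{sm}$ ($i=1,\dots,m$); $e_k$ is the $k$th canonical basis vector of $\mathbb{R}^{sm}$; $\|\cdot\|_F$ is the Frobenius norm and $\|\cdot\|_2$ the Euclidean norm of a (row) vector. The matrix $T_m=V_m^TAV_m$ is symmetric negative definite, so the reduced Lyapunov equation has a unique solution $Y_m$ and each $D_j$ is invertible. The reduced equation is equivalent to the Galerkin condition $V_m^TR_mV_m=0$. The matrix $\tau_{m+1,m}$ is the last $s\times s$ block (lower right corner) of $V_{m+1}^TAV_m\in\mathbb{R}^{s(m+1)\times sm}$. *)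

(* Defs.v *)
From mathcomp Require Import all_boot all_order all_algebra.
From mathcomp Require Import reals.

Set Implicit Arguments.
Unset Strict Implicit.
Unset Printing Implicit Defensive.

Import Order.TTheory GRing.Theory Num.Theory.
Local Open Scope ring_scope.

Definition negdefmx (R : realType) (n : nat) (A : 'M[R]_n) : Prop :=
  forall x : 'cV[R]_n, x != 0 -> (x^T *m A *m x) 0 0 < 0.

Definition orthonormal_cols (R : realType) (p q : nat) (M : 'M[R]_(p, q)) : Prop :=
  M^T *m M = 1%:M.

Definition frobenius_norm (R : realType) (p q : nat) (M : 'M[R]_(p, q)) : R :=
  Num.sqrt (\sum_(i < p) \sum_(j < q) M i j ^+ 2).

Definition euclidean_norm (R : realType) (q : nat) (v : 'rV[R]_q) : R :=
  Num.sqrt (\sum_(j < q) v 0 j ^+ 2).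

Definition mxrange (R : realType) (p q : nat) (M : 'M[R]_(p, q)) : {vspace 'cV[R]_p} :=
  limg (linfun (mulmx M : 'cV[R]_q -> 'cV[R]_p)).

(* The number of columns of m blocks of width s is written \sum_(i < m) s, the
   width of a \mxrow; it is equal, but not convertible, to s * m. *)
Definition krylov_mx (R : realType) (n s : nat) (A : 'M[R]_n) (C : 'M[R]_(n, s))
    (j : nat) : 'M[R]_(n, \sum_(i < j) s) :=
  \mxrow_(i < j) (A ^+ i *m C).

Definition block_krylov (R : realType) (n s : nat) (A : 'M[R]_n) (C : 'M[R]_(n, s))
    (j : nat) : {vspace 'cV[R]_n} :=
  mxrange (krylov_mx A C j).

(* [V 0, ..., V (j - 1)]; block indices start at 0, so that V i is the (i + 1)-st
   block. *)
Definition block_row (R : realType) (n s : nat) (V : nat -> 'M[R]_(n, s)) (j : nat) :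
    'M[R]_(n, \sum_(i < j) s) :=
  \mxrow_(i < j) V i.

Definition orthonormal_krylov_basis (R : realType) (n s : nat) (A : 'M[R]_n)
    (C : 'M[R]_(n, s)) (k : nat) (V : nat -> 'M[R]_(n, s)) : Prop :=
  forall j : nat, (1 <= j <= k)%N ->
    orthonormal_cols (block_row V j) /\ mxrange (block_row V j) = block_krylov A C j.

Definition id_block (R : realType) (m s : nat) (i : 'I_m) : 'M[R]_(\sum_(k < m) s, s) :=
  submxrow (1%:M : 'M[R]_(\sum_(k < m) s)) i.
Arguments id_block {R m} s i.

(* Main.v *)
(* Since the blocks [V_i] span nested Krylov spaces, [A V_m = V_m T_m + U tau E_m^T]
   with [U = V_(m+1)] orthogonal to [V_m].  The reduced equation then cancels the
   [V_m]-part of the residual and leaves [R_m = P + P^T] with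
   [P = U tau E_m^T Y_m V_m^T]; as [P P = 0], [|R_m|^2 = 2 |P|^2 = 2 |Y_m E_m tau^T|^2].
   In the eigenbasis of [T_m], row [j] of [Q^T Y_m Q] is [- e_j^T S_m D_j^-1]. *)
Require Import Defs.
From mathcomp Require Import all_boot all_order all_algebra.
From mathcomp Require Import reals.

Set Implicit Arguments.
Unset Strict Implicit.
Unset Printing Implicit Defensive.

Import Order.TTheory GRing.Theory Num.Theory.
Local Open Scope ring_scope.

(** * Frobenius norms as traces, and their orthogonal invariance *)

Section Frobenius.

Variable R : realType.

Lemma sqr_frobenius_norm p q (M : 'M[R]_(p, q)) :
  frobenius_norm M ^+ 2 = \tr (M^T *m M).
Proof.
rewrite sqr_sqrtr; last by do 2!apply: sumr_ge0 => ? _; exact: sqr_ge0.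
rewrite exchange_big /mxtrace; apply: eq_bigr => j _.
by rewrite mxE; apply: eq_bigr => i _; rewrite mxE expr2.
Qed.

Lemma sqr_euclidean_norm q (v : 'rV[R]_q) :
  euclidean_norm v ^+ 2 = \sum_(j < q) v 0 j ^+ 2.
Proof. by rewrite sqr_sqrtr //; apply: sumr_ge0 => ? _; exact: sqr_ge0. Qed.

Lemma euclidean_normN q (v : 'rV[R]_q) : euclidean_norm (- v) = euclidean_norm v.
Proof.
by rewrite /euclidean_norm; under eq_bigr do rewrite mxE sqrrN.
Qed.

Lemma sqr_frobenius_norm_rows p q (M : 'M[R]_(p, q)) :
  frobenius_norm M ^+ 2 = \sum_(i < p) euclidean_norm (row i M) ^+ 2.
Proof.
rewrite sqr_sqrtr; last by do 2!apply: sumr_ge0 => ? _; exact: sqr_ge0.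
apply: eq_bigr => i _; rewrite sqr_euclidean_norm.
by apply: eq_bigr => j _; rewrite mxE.
Qed.

Lemma sqr_frobenius_norm_mul p q r (M : 'M[R]_(p, q)) (B : 'M[R]_(q, r)) :
  orthonormal_cols M -> frobenius_norm (M *m B) ^+ 2 = frobenius_norm B ^+ 2.
Proof.
move=> MM; rewrite !sqr_frobenius_norm trmx_mul mulmxA -(mulmxA _ M^T) MM.
by rewrite mulmx1.
Qed.

Lemma sqr_frobenius_norm_tr p q (M : 'M[R]_(p, q)) :
  frobenius_norm M^T ^+ 2 = frobenius_norm M ^+ 2.
Proof. by rewrite !sqr_frobenius_norm trmxK mxtrace_mulC. Qed.

(** The cross terms are the traces of [P *m P] and its transpose, hence vanish; the two remaining
    traces agree by cyclicity. *)
Lemma sqr_frobenius_norm_addtr p (P : 'M[R]_p) :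
  P *m P = 0 -> frobenius_norm (P + P^T) ^+ 2 = 2 * frobenius_norm P ^+ 2.
Proof.
move=> PP; rewrite !sqr_frobenius_norm [(P + P^T)^T]linearD /= trmxK.
rewrite mulmxDl !mulmxDr PP -trmx_mul PP trmx0 addr0 add0r.
by rewrite mxtraceD (mxtrace_mulC P) mulr_natl.
Qed.

End Frobenius.

Section NegativeDefinite.

Variable R : realType.

(** The entry is the quadratic form of [A] at column [j] of [M]. It serves to show that the
    eigenvalues of [Tm] are negative. *)
Lemma negdefmx_compress_diag p q (A : 'M[R]_p) (M : 'M[R]_(p, q)) j :
  negdefmx A -> orthonormal_cols M -> (M^T *m A *m M) j j < 0.
Proof.
move=> negA MM.
have e B : ((col j M)^T *m B *m col j M) 0 0 = (M^T *m B *m M) j j.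
  by rewrite tr_col -!row_mul colE mulmxA -colE !mxE.
(* Taking [B] to be the identity, a zero column would give [0 = 1]. *)
rewrite -e; apply: negA; apply/eqP => M0; have := e 1%:M.
by rewrite M0 mulmx0 mulmx1 MM !mxE eqxx => /eqP; rewrite eq_sym oner_eq0.
Qed.

End NegativeDefinite.

(** * The Lyapunov equation in the eigenbasis *)

Section DiagonalLyapunov.

Variables (R : realType) (q : nat) (l : 'rV[R]_q).
Hypothesis l_neg : forall j, l 0 j < 0.
Variables S Z : 'M[R]_q.
Hypothesis lyap : diag_mx l *m Z + Z *m diag_mx l + S = 0.

(** The equation decouples entrywise, and the sums of two negative eigenvalues are nonzero, so [S]
    determines each entry of [Z]. *)
Lemma diag_lyapunov_sym : S^T = S -> Z^T = Z.
Proof.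
move=> Ssym; apply/matrixP => i j; rewrite mxE.
have E a b : Z a b * (l 0 a + l 0 b) = - S a b.
  apply/eqP; rewrite -addr_eq0; apply/eqP.
  move/matrixP/(_ a b): lyap; rewrite mul_diag_mx mul_mx_diag !mxE => <-.
  by rewrite mulrDr (mulrC (Z a b) (l 0 a)).
have nz : l 0 i + l 0 j != 0 by rewrite ltr0_neq0 // -[ltRHS]addr0 ltrD.
apply: (mulIf nz); rewrite E addrC E; congr (- _).
by rewrite -[in RHS]Ssym mxE.
Qed.

(** Left multiplication by [diag_mx l] scales row [j] by [l 0 j], so row [j] of the equation is a
    linear system with matrix [D_j], diagonal with negative entries. *)
Lemma diag_lyapunov_row j :
  row j S *m invmx ((l 0 j)%:M + diag_mx l) = - row j Z.
Proof.
have De : (l 0 j)%:M + diag_mx l = diag_mx (const_mx (l 0 j) + l).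
  by rewrite linearD /= diag_const_mx.
have uD : (l 0 j)%:M + diag_mx l \in unitmx.
  rewrite De unitmxE det_diag unitfE; apply/prodf_neq0 => k _.
  by rewrite !mxE ltr0_neq0 // ltr_nDl.
apply: (canLR (mulmxK uD)); rewrite mulNmx mulmxDr.
apply/eqP; rewrite -addr_eq0 addrC; apply/eqP.
move/(congr1 (row j)): lyap; rewrite !linearD /= linear0 => <-.
congr (_ + _ + _); last by rewrite row_mul.
by apply/rowP => k; rewrite mul_mx_scalar mul_diag_mx !mxE.
Qed.

End DiagonalLyapunov.

(** * Block Krylov bases and the block Lanczos relation *)

Section KrylovBasis.

Variable R : realType.

(** The columns of [X] are chosen preimages under [N] of the columns of [M]. *)
Lemma mxrange_sub_factor p q r (M : 'M[R]_(p, q)) (N : 'M[R]_(p, r)) :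
  (mxrange M <= mxrange N)%VS -> exists X, M = N *m X.
Proof.
move=> sMN.
have xP j : exists x : 'cV[R]_r, col j M == N *m x.
  have /(subvP sMN) : col j M \in mxrange M.
    by rewrite colE -[M *m _]/(mulmx M _) -lfunE memv_img ?memvf.
  by case/memv_imgP => x _; rewrite lfunE => ->; exists x.
exists (\matrix_(i, j) xchoose (xP j) i 0).
apply/matrixP => i j; have /eqP/colP/(_ i) := xchooseP (xP j).
by rewrite !mxE => ->; apply: eq_bigr => k _; rewrite !mxE.
Qed.

Lemma block_rowE n s (V : nat -> 'M[R]_(n, s)) j (i : 'I_j) :
  block_row V j *m id_block s i = V i.
Proof. by rewrite mul_submxrow mulmx1 mxrowK. Qed.

Lemma id_block_ortho m s (i k : 'I_m) :
  (id_block s i)^T *m id_block s k = (i == k)%:R%:M :> 'M[R]_s.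
Proof.
rewrite /id_block tr_submxrow trmx1 mul_submxrow submxcol_mul mulmx1.
rewrite -submxblockEv -mxdiagZ mxblockK.
by rewrite conform_mx_id; case: eqP => _; rewrite ?raddf0.
Qed.

Lemma block_row_ortho n s (V : nat -> 'M[R]_(n, s)) j (i k : 'I_j) :
  orthonormal_cols (block_row V j) -> (V i)^T *m V k = (i == k)%:R%:M.
Proof.
move=> VV; rewrite -!block_rowE trmx_mul -mulmxA (mulmxA (block_row V j)^T) VV.
by rewrite mul1mx id_block_ortho.
Qed.

Lemma block_row_proj n s (V : nat -> 'M[R]_(n, s)) j :
  block_row V j *m (block_row V j)^T = \sum_(i < j) V i *m (V i)^T.
Proof. by rewrite /block_row tr_mxrow mul_mxrow_mxcol. Qed.

Variables (n s : nat) (A : 'M[R]_n) (C : 'M[R]_(n, s)) (m : nat).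
Variable V : nat -> 'M[R]_(n, s).
Hypothesis V_basis : orthonormal_krylov_basis A C m.+1 V.

Let ortho j k : (j < m.+1)%N -> (k < m.+1)%N -> (V j)^T *m V k = (j == k)%:R%:M.
Proof.
move=> jm km; have [|VV _] := V_basis (j := m.+1); first by rewrite leqnn.
exact: (block_row_ortho (Ordinal jm) (Ordinal km) VV).
Qed.

Let ortho0 k : (k < m)%N -> (V m)^T *m V k = 0.
Proof.
move=> km; rewrite (ortho (ltnSn m) (leqW km)) (gtn_eqF km).
by rewrite -scalemx1 scale0r.
Qed.

(* [A] maps the [j]-th Krylov space into the [(j+1)]-st, on which the orthogonal
   projection acts as the identity. *)
Lemma krylov_proj_mul j : (1 <= j <= m)%N ->
  (\sum_(i < j.+1) V i *m (V i)^T) *m (A *m block_row V j) = A *m block_row V j.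
Proof.
case/andP => j1 jm; rewrite -block_row_proj.
have [|_ rj] := V_basis (j := j); first by rewrite j1 leqW.
have [|oS rS] := V_basis (j := j.+1); first by rewrite /= ltnS.
have /mxrange_sub_factor[X ->] : (mxrange (block_row V j) <= mxrange (krylov_mx A C j))%VS.
  by rewrite rj.
have /mxrange_sub_factor[Y KY] :
    (mxrange (krylov_mx A C j.+1) <= mxrange (block_row V j.+1))%VS by rewrite rS.
rewrite !mulmxA; congr (_ *m X); rewrite -mulmxA [A *m _]mul_mxrow mul_mxrow.
apply/eq_mxrowP => i.
(* Multiplication by [A] shifts the Krylov blocks: block [i] becomes block [i + 1] of the next
   Krylov matrix. *)
have -> : A *m (A ^+ i *m C) = krylov_mx A C j.+1 *m id_block s (lift ord0 i).
  by rewrite mul_submxrow mulmx1 mxrowK mulmxA exprS.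
rewrite KY !mulmxA -(mulmxA _ _ (block_row V j.+1)).
by rewrite oS mulmx1.
Qed.

(** The block Hessenberg structure: [A *m V i] involves only the blocks up to [V i.+1]. *)
Lemma krylov_block_proj i : (i < m)%N ->
  (\sum_(k < i.+2) V k *m (V k)^T) *m (A *m V i) = A *m V i.
Proof.
move=> im; have := krylov_proj_mul (j := i.+1).
rewrite /= im => /(_ isT) /(congr1 (fun B => B *m id_block s ord_max)).
by rewrite -!mulmxA block_rowE.
Qed.

Lemma last_block_ortho : (V m)^T *m block_row V m = 0.
Proof.
rewrite mul_mxrow -[RHS]mxrow0; apply/eq_mxrowP => i.
exact: ortho0 (ltn_ord i).
Qed.

Lemma last_block_mul (m_ge1 : (1 <= m)%N) :
  (V m)^T *m A *m block_row V m =
  (V m)^T *m A *m V m.-1 *m (id_block s (rev_ord (Ordinal m_ge1)))^T.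
Proof.
apply/mxrowP => i; rewrite -(mulmx1 (block_row V m)) !mulmxA.
rewrite -[X in _ = submxrow X i]mulmx1 -!mul_submxrow -![submxrow 1%:M i]/(id_block s i).
rewrite -2!mulmxA block_rowE -[in RHS]mulmxA id_block_ortho mul_mx_scalar.
(* [rev_ord] of index 0 is [m - 1]. Any other [i] has [i + 1 < m], so [A *m V i] stays in the span
   of blocks orthogonal to [V m]. *)
case: eqP => [<- | /eqP ne]; first by rewrite scale1r /= subn1 mulmxA.
have im : (i.+1 < m)%N.
  rewrite ltn_neqAle ltn_ord andbT; apply: contra_neq ne => e.
  by apply/val_inj; move/(congr1 predn): e => /= ->; rewrite subn1.
rewrite scale0r -(krylov_block_proj (ltn_ord i)) mulmxA mulmx_sumr big1 ?mul0mx //.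
move=> k _; have km : (k < m)%N by apply: leq_trans (ltn_ord k) im.
by rewrite mulmxA ortho0 // mul0mx.
Qed.

(** The projection onto all [m + 1] blocks fixes the left side; its first [m] blocks yield the first
    term, its last block the second. *)
Lemma block_lanczos (m_ge1 : (1 <= m)%N) :
  A *m block_row V m =
    block_row V m *m ((block_row V m)^T *m A *m block_row V m)
    + V m *m ((V m)^T *m A *m V m.-1) *m (id_block s (rev_ord (Ordinal m_ge1)))^T.
Proof.
rewrite -{1}(krylov_proj_mul (j := m)) ?m_ge1 ?leqnn //.
rewrite big_ord_recr /= -block_row_proj mulmxDl -!mulmxA; congr (_ + _ *m _).
by have := last_block_mul m_ge1; rewrite -!mulmxA.
Qed.

End KrylovBasis.

Theorem proposition3p1 (R : realType) (n s m : nat) (m_ge1 : (1 <= m)%N)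
    (A : 'M[R]_n) (C : 'M[R]_(n, s))
    (A_sym : A \is symmetricmx) (A_neg : negdefmx A)
    (full_rank : forall j : nat, (1 <= j <= m.+1)%N ->
       \dim (block_krylov A C j) = (s * j)%N)
    (V : nat -> 'M[R]_(n, s))
    (V_basis : orthonormal_krylov_basis A C m.+1 V)
    (gamma : 'M[R]_s) (gamma_unit : gamma \in unitmx)
    (C_eq : C = V 0%N *m gamma) :
  let E1 : 'M[R]_(\sum_(i < m) s, s) := id_block s (Ordinal m_ge1) in
  let Em : 'M[R]_(\sum_(i < m) s, s) := id_block s (rev_ord (Ordinal m_ge1)) in
  let Vm := block_row V m in
  let Tm := Vm^T *m A *m Vm in
  let tau := (V m)^T *m A *m V m.-1 in
  forall Ym : 'M[R]_(\sum_(i < m) s),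
    Tm *m Ym + Ym *m Tm + E1 *m gamma *m gamma^T *m E1^T = 0 ->
  let Xm := Vm *m Ym *m Vm^T in
  let Rm := A *m Xm + Xm *m A + C *m C^T in
  forall (Qm : 'M[R]_(\sum_(i < m) s)) (lambda : 'rV[R]_(\sum_(i < m) s)),
    orthonormal_cols Qm ->
    let Lambda := diag_mx lambda in
    Tm = Qm *m Lambda *m Qm^T ->
  let Sm := Qm^T *m E1 *m gamma *m gamma^T *m E1^T *m Qm in
  let Wm := Qm^T *m Em *m tau^T in
  let D j := (lambda 0 j)%:M + Lambda in
  let e j : 'cV[R]_(\sum_(i < m) s) := delta_mx j 0 in
  frobenius_norm Rm ^+ 2 =
    2 * \sum_(j < (\sum_(i < m) s)%N)
          euclidean_norm ((e j)^T *m Sm *m invmx (D j) *m Wm) ^+ 2.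
Proof.
move=> E1 Em Vm Tm tau Y eqY Xm Rm Q l QQ Lam TE Sm Wm D e.
have AT : A^T = A.
  by have /is_hermitianmxP := A_sym; rewrite expr0 scale1r map_mx_id => [<-|].
have [|VV _] := V_basis m; first by rewrite m_ge1 leqnSn.
have [|VV1 _] := V_basis m.+1; first by rewrite leqnn.
have UU : (V m)^T *m V m = 1%:M.
  by have := block_row_ortho ord_max ord_max VV1; rewrite eqxx.
have UVm : (V m)^T *m Vm = 0 := last_block_ortho V_basis.
have QQ' : Q *m Q^T = 1%:M by exact: mulmx1C.
(* The eigenvalues are the diagonal entries of [A] compressed to the orthonormal columns of
   [Vm *m Q]. *)
have l_neg j : l 0 j < 0.
  suff <- : ((Vm *m Q)^T *m A *m (Vm *m Q)) j j = l 0 j.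
    apply: negdefmx_compress_diag => //.
    by rewrite /orthonormal_cols trmx_mul mulmxA -(mulmxA Q^T) VV mulmx1.
  rewrite trmx_mul !mulmxA -2!(mulmxA Q^T) -/Tm TE !mulmxA QQ mul1mx.
  by rewrite -mulmxA QQ mulmx1 mxE eqxx.
pose Z := Q^T *m Y *m Q.
have YE : Y = Q *m Z *m Q^T by rewrite /Z !mulmxA QQ' mul1mx -mulmxA QQ' mulmx1.
have lyapZ : Lam *m Z + Z *m Lam + Sm = 0.
  have LE : Lam = Q^T *m Tm *m Q by rewrite TE !mulmxA QQ mul1mx -mulmxA QQ mulmx1.
  move/(congr1 (fun B => Q^T *m B *m Q)): eqY.
  rewrite mulmx0 mul0mx !mulmxDr !mulmxDl => <-; rewrite LE /Z /Sm.
  by rewrite !mulmxA -!(mulmxA _ Q Q^T) QQ' !mulmx1.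
have Ssym : Sm^T = Sm by rewrite /Sm !trmx_mul !trmxK !mulmxA.
have Zsym : Z^T = Z := diag_lyapunov_sym l_neg lyapZ Ssym.
have Ysym : Y^T = Y by rewrite YE 2!trmx_mul trmxK Zsym mulmxA.
have Tsym : Tm^T = Tm by rewrite /Tm !trmx_mul trmxK AT mulmxA.
(* The transpose isolates the factor whose norm is wanted; since [Y] is symmetric, this is
   [V m *m tau *m Em^T *m Y *m Vm^T]. *)
pose P := V m *m (Y *m Em *m tau^T)^T *m Vm^T.
have AV : A *m Vm = Vm *m Tm + V m *m tau *m Em^T := block_lanczos V_basis m_ge1.
(* Opaque, so that [trmx_mul] does not unfold these names. *)
clearbody Tm tau Z.
have VA : Vm^T *m A = Tm *m Vm^T + Em *m tau^T *m (V m)^T.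
  have := congr1 trmx AV; rewrite trmx_mul AT => ->.
  by rewrite linearD /= !trmx_mul Tsym trmxK mulmxA.
have CE : C *m C^T = Vm *m (E1 *m gamma *m gamma^T *m E1^T) *m Vm^T.
  have -> : C = Vm *m E1 *m gamma by rewrite block_rowE.
  by rewrite !trmx_mul !mulmxA.
have AX : A *m Xm = Vm *m (Tm *m Y) *m Vm^T + P.
  by rewrite /Xm !mulmxA AV !mulmxDl /P !trmx_mul trmxK Ysym !mulmxA.
have XA : Xm *m A = Vm *m (Y *m Tm) *m Vm^T + P^T.
  by rewrite /Xm -(mulmxA _ _ A) VA mulmxDr /P !trmx_mul !trmxK !mulmxA.
have RE : Rm = P + P^T.
  (* The three terms other than [P] and [P^T] share the outer factors [Vm] and [Vm^T], and their
     middle factors sum to the reduced equation. *)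
  rewrite /Rm AX XA CE addrACA [LHS]addrAC -!mulmxDl -!mulmxDr eqY.
  by rewrite mulmx0 mul0mx add0r.
have PP : P *m P = 0.
  rewrite /P -!mulmxA (mulmxA Vm^T).
  have -> : Vm^T *m V m = 0 by rewrite -[LHS]trmxK trmx_mul trmxK UVm trmx0.
  by rewrite mul0mx !mulmx0.
rewrite RE sqr_frobenius_norm_addtr //; congr (_ * _).
rewrite /P -mulmxA sqr_frobenius_norm_mul //.
(* Transposing brings [Vm] to the left, where its orthonormal columns drop out. *)
rewrite -sqr_frobenius_norm_tr trmx_mul !trmxK sqr_frobenius_norm_mul //.
have -> : Y *m Em *m tau^T = Q *m (Z *m Wm).
  by rewrite {1}YE /Wm !mulmxA.
rewrite sqr_frobenius_norm_mul // sqr_frobenius_norm_rows.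
apply: eq_bigr => j _; congr (_ ^+ 2).
by rewrite /e trmx_delta -rowE (diag_lyapunov_row l_neg lyapZ) mulNmx euclidean_normN row_mul.
Qed.
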